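(* Let $X_1,X_2,\ldots$ be a sequence of i.i.d. real-valued random variables, and let $h:\mathbb{R}\to\mathbb{R}$ be a non-decreasing function such that $$\mathbb{E}\big[|h(X_1-r)|\log^+|h(X_1-r)|\big]<\infty\quad\text{for every real } r.$$ Assume that the equation $\mathbb{E}\,h(X_1-x)=0$ has the unique solution $x=0$. For arbitrary initial values $s_1,\hat s_1\in\mathbb{R}$, consider the implicit stochastic approximations, for $n\ge2$, $$\frac1n h(X_n-s_n)+s_{n-1}=s_n$$ and $$\frac1n h(X_n-\hat s_n)+h(\hat s_{n-1}-\hat s_n)=0.$$ Then: (1) the sequence $\{s_n\}_{n\ge1}$ converges to $0$ almost surely; (2) if additionally $h^{-1}$ exists and satisfies $h^{-1}(x)=x+O(x^2)$ in a neighborhood of $0$, the sequence $\{\hat s_n\}_{n\ge1}$ converges to $0$ almost surely.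
   Context: $\log^+ t=\max\{\log t,0\}$, with $0\log^+0=0$. The sequences $(s_n)$ and $(\hat s_n)$ are real-valued random sequences satisfying the respective implicit equations for all $n\ge2$. ''$h^{-1}$ exists'' means that $h$ is injective, $h^{-1}$ being its inverse on the range $h(\mathbb{R})$; the second condition means that the range contains a neighborhood of $0$ and there are $C,\delta>0$ with $|h^{-1}(x)-x|\le Cx^2$ for $|x|<\delta$. *)

(* Defs.v *)
From HB Require Import structures.
From mathcomp Require Import all_boot all_order all_algebra finmap.
From mathcomp Require Import all_classical all_reals all_analysis.

Set Implicit Arguments.
Unset Strict Implicit.
Unset Printing Implicit Defensive.
Import Order.TTheory GRing.Theory Num.Theory.
Import numFieldNormedType.Exports.

Local Open Scope classical_set_scope.
Local Open Scope ring_scope.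

(* [ln] is 0 on nonpositive reals, so [t * logp t = 0] at [t = 0]. *)
Definition logp (R : realType) (t : R) : R := Num.max (ln t) 0.

Definition independent_on (d : measure_display) (T : measurableType d)
    (R : realType) (P : probability T R) (D : set nat)
    (X : nat -> {RV P >-> R}) : Prop :=
  forall (J : {fset nat}) (A : nat -> set R),
    [set` J] `<=` D ->
    (forall i, measurable (A i)) ->
    P (\bigcap_(i in [set` J]) (X i @^-1` A i)) =
    (\prod_(i <- J) P (X i @^-1` A i))%E.

(* Equality of laws is only required on measurable sets: the value of a
   measure on other sets carries no information. *)
Definition identically_distributed_on (d : measure_display)
    (T : measurableType d) (R : realType) (P : probability T R) (D : set nat)
    (X : nat -> {RV P >-> R}) : Prop :=
  forall i j, D i -> D j -> forall A : set R, measurable A ->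
    distribution P (X i) A = distribution P (X j) A.

(* For sequences indexed from 1; the entry of index 0 is unconstrained. *)
Definition iid1 (d : measure_display) (T : measurableType d)
    (R : realType) (P : probability T R) (X : nat -> {RV P >-> R}) : Prop :=
  independent_on [set n | (1 <= n)%N] X /\
  identically_distributed_on [set n | (1 <= n)%N] X.

(* ['pinv_(fun=> 0) setT h] is the inverse of an injective [h] on [range h];
   its values elsewhere are irrelevant, since 0 is interior to [range h]. *)
Definition inverse_id_plus_bigO_sqr (R : realType) (h : R -> R) : Prop :=
  nbhs (0 : R) (range h) /\
  exists C delta : R, [/\ 0 < C, 0 < delta &
    forall x : R, `|x| < delta ->
      `|'pinv_(fun=> 0) setT h x - x| <= C * x ^+ 2].

(* Main.v *)
Require Import Defs.
From HB Require Import structures.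
From mathcomp Require Import all_boot all_order all_algebra finmap.
From mathcomp Require Import all_classical all_reals all_analysis.
From mathcomp Require Import measurable_realfun.
From mathcomp Require Import zify ring lra.

(** Both recursions have the form
      [phi (s_(n-1) - s_n) = - h (X_n - s_n) / n],
    with [phi] the identity in the first case and [phi = h] in the second; [phi]
    is increasing and its inverse is [z + O(z ^+ 2)] near 0. They are treated
    together in [implicit_approximation_cvg0].

    Fix a level [eps > 0] and put [Y_n = h (X_n - eps)]. As [h] is
    non-decreasing, so that [E h (X_1 - x)] is non-increasing in [x], and as 0 is
    the only zero of the latter, [Y_n] has negative mean [mu]. While [s_n > eps],
    the monotonicity of [h] bounds the implicit term [h (X_n - s_n)] by the
    explicit one [Y_n], and [s_n - s_(n-1)] is at most
    [Y_n / n + O((Y_n / n) ^+ 2)]. By the strong law of large numbers the averages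
    [a_n] of [Y_1, ..., Y_n] tend to [mu]; in particular [Y_n / n] tends to 0, so
    that the quadratic error is at most [eta * |Y_n| / n] with [eta] as small as
    desired, and may be absorbed into [Y_n] without making its mean nonnegative.
    Summation by parts gives
      [Y_n / n = a_n - a_(n-1) + a_(n-1) / n],
    so [s_n - a_n] decreases by about [- mu / n] at each step spent above [eps].
    Since the harmonic series diverges, [s] must come down to [eps], and since
    [a_n] converges, later excursions above [eps] are eventually arbitrarily small
    ([drift_eventually_le]). Hence the upper limit of [s] is at most [eps], and a
    reflection gives the lower limit. The randomness enters only through the
    convergence of averages on one almost sure event.

    The strong law ([strong_law]) is proved by Etemadi's method: for nonnegative
    integrable terms, truncation and a variance bound give convergence of the
    averages along geometrically growing times ([block_lln]); the partial sums
    being monotone, this extends to all times as the growth rate tends to 1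
    ([cvg_mean_of_blocks]). *)

Set Implicit Arguments.
Unset Strict Implicit.
Unset Printing Implicit Defensive.
Import Order.TTheory GRing.Theory Num.Theory.
Import numFieldNormedType.Exports.

Local Open Scope classical_set_scope.
Local Open Scope ring_scope.

(** * Pairwise independent, identically distributed variables *)

Definition pairwise_iid (d : measure_display) (T : measurableType d)
    (R : realType) (P : probability T R) (X : nat -> {RV P >-> R}) : Prop :=
  (forall j k, j != k -> forall A B : set R, measurable A -> measurable B ->
     P (X j @^-1` A `&` X k @^-1` B) =
     (P (X j @^-1` A) * P (X k @^-1` B))%E) /\
  (forall k (A : set R), measurable A ->
     distribution P (X k) A = distribution P (X 0%N) A).

Section PairwiseIid.
Context (d : measure_display) (T : measurableType d) (R : realType)
  (P : probability T R) (X : nat -> {RV P >-> R}).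
Hypothesis X_iid : pairwise_iid X.

Lemma integral_ident (k : nat) (f : R -> R) :
  measurable_fun [set: R] f -> (forall x, 0 <= f x) ->
  (\int[P]_w (f (X k w))%:E = \int[P]_w (f (X 0%N w))%:E)%E.
Proof.
move=> mf f0; have mf' := (measurable_EFinP [set: R] f).2 mf.
have f0' y : (0 <= (EFin \o f) y)%E by rewrite lee_fin.
rewrite -[LHS](ge0_integral_distribution (X k) mf' f0').
rewrite -[RHS](ge0_integral_distribution (X 0%N) mf' f0').
by apply: eq_measure_integral => A mA _; exact: X_iid.2.
Qed.

(** Independence says that the joint law of [X j] and [X k] agrees with the
    product of the marginal laws on rectangles, hence everywhere; Tonelli's
    theorem then factors the integral. *)
Lemma integral_pairwise_mul (j k : nat) (f g : R -> R) : j != k ->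
  measurable_fun [set: R] f -> (forall x, 0 <= f x) ->
  measurable_fun [set: R] g -> (forall x, 0 <= g x) ->
  (\int[P]_w (f (X j w) * g (X k w))%:E =
   \int[P]_w (f (X j w))%:E * \int[P]_w (g (X k w))%:E)%E.
Proof.
move=> jk mf f0 mg g0.
have f0' y : (0 <= (EFin \o f) y)%E by rewrite lee_fin.
have g0' y : (0 <= (EFin \o g) y)%E by rewrite lee_fin.
have mXX : measurable_fun setT (fun w => (X j w, X k w)).
  by apply/measurable_fun_pairP; split => //=.
pose fg (z : R * R) : \bar R := (f z.1 * g z.2)%:E.
have mfg : measurable_fun [set: R * R] fg.
  apply/measurable_EFinP; apply: measurable_funM;
  by apply: measurableT_comp.
have fg0 z : (0 <= fg z)%E by rewrite lee_fin mulr_ge0.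
have joint : (\int[P]_w fg (X j w, X k w) =
    \int[distribution P (X j) \x distribution P (X k)]_z fg z)%E.
  pose XX : {mfun T >-> (R * R)%type} := HB.pack (fun w => (X j w, X k w))
    (isMeasurableFun.Build _ _ _ _ _ mXX).
  rewrite -[LHS](@ge0_integral_distribution _ _ _ _ _ P XX fg)//.
  apply: eq_measure_integral => A mA _; apply/esym.
  apply: product_measure_unique => //= B C mB mC.
  by rewrite -(X_iid.1 j k jk).
rewrite -[LHS]/(\int[P]_w fg (X j w, X k w))%E joint fubini_tonelli1//=.
transitivity (\int[distribution P (X j)]_x
   ((f x)%:E * \int[P]_w (g (X k w))%:E))%E.
  apply: eq_integral => x _ /=.
  rewrite /fubini_F /fg /=.
  under eq_integral do rewrite EFinM.
  rewrite ge0_integralZl//=; last 3 first.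
  - by apply/measurable_EFinP.
  - by move=> y _; rewrite lee_fin.
  - by rewrite lee_fin.
  congr (_ * _)%E.
  exact: (ge0_integral_distribution (X k) ((measurable_EFinP _ _).2 mg) g0').
have G0 : (0 <= \int[P]_w (g (X k w))%:E)%E.
  by apply: integral_ge0 => w _; rewrite lee_fin.
rewrite (@ge0_integralZr _ _ _ _ _ _ (EFin \o f))//=; last 2 first.
- exact/measurable_EFinP.
- by move=> y _; rewrite lee_fin.
congr (_ * _)%E.
exact: (ge0_integral_distribution (X j) ((measurable_EFinP _ _).2 mf) f0').
Qed.

End PairwiseIid.

(** The sum of the series has finite expectation, so it is almost surely finite
    and its terms tend to 0. This replaces the pair formed by Chebyshev's
    inequality and the Borel-Cantelli lemma. *)
Lemma ae_cvg0_summable (d : measure_display) (T : measurableType d)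
    (R : realType) (P : {measure set T -> \bar R}) (f : nat -> T -> R) (C : R) :
  (forall n, measurable_fun setT (f n)) -> (forall n w, 0 <= f n w) ->
  (forall N, (\sum_(0 <= n < N) \int[P]_w (f n w)%:E <= C%:E)%E) ->
  {ae P, forall w, f n w @[n --> \oo] --> (0 : R)}.
Proof.
move=> mf f0 fC.
pose F w : \bar R := (\sum_(n <oo) (f n w)%:E)%E.
have F0 n w : (0 <= (f n w)%:E)%E by rewrite lee_fin.
have mFn n : measurable_fun setT (EFin \o f n) by exact/measurable_EFinP.
have F_int : P.-integrable setT F.
  apply/integrableP; split.
    have -> : F = (fun w => \sum_(n <oo | n \in xpredT) (f n w)%:E)%E.
      by apply/funext => w; apply: eq_eseriesl.
    by apply: ge0_emeasurable_sum => *; [exact: F0|exact: mFn].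
  under eq_integral do rewrite gee0_abs ?nneseries_ge0//.
  rewrite integral_nneseries// (@le_lt_trans _ _ C%:E) ?ltry//.
  apply: lime_le; last by apply: nearW => N; exact: fC.
  by apply: is_cvg_nneseries => n _ _; exact: integral_ge0.
apply: filterS (integrable_ae measurableT F_int) => w /(_ I) Ffin.
apply: cvg_series_cvg_0; apply: nnseries_is_cvg => //.
by rewrite -ge0_fin_numE // nneseries_ge0.
Qed.

Lemma bounded_integrable (d : measure_display) (T : measurableType d)
    (R : realType) (P : probability T R) (g : T -> R) (M : R) :
  measurable_fun [set: T] g -> (forall w, `|g w| <= M) ->
  P.-integrable [set: T] (EFin \o g).
Proof.
move=> mg gM; apply: measurable_bounded_integrable => //.
  exact: (le_lt_trans (probability_le1 P measurableT) (ltry 1)).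
exists M; split; first exact: num_real.
by move=> y My w _; rewrite /= (le_trans (gM w))// ltW.
Qed.

Section SecondMoment.
Context (d : measure_display) (T : measurableType d) (R : realType)
  (P : probability T R) (X : nat -> {RV P >-> R}).
Hypothesis X_iid : pairwise_iid X.
Variables (f : R -> R) (M : R).
Hypotheses (mf : measurable_fun [set: R] f) (f0 : forall x, 0 <= f x)
  (fM : forall x, f x <= M).

Let Z k w := f (X k w).
Let S n w := \sum_(k < n) Z k w.
Let m := \int[P]_w Z 0%N w.

Let mZ k : measurable_fun [set: T] (Z k).
Proof. exact: measurableT_comp. Qed.

Let mS n : measurable_fun [set: T] (S n).
Proof. exact: measurable_sum. Qed.

Let S_ge0 n w : 0 <= S n w.
Proof. by apply: sumr_ge0 => k _; exact: f0. Qed.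

Let Z_ge0 k w : 0 <= Z k w.
Proof. exact: f0. Qed.

Let Z_le k w : Z k w <= M.
Proof. exact: fM. Qed.

Let M_ge0 : 0 <= M.
Proof. exact: le_trans (f0 0) (fM 0). Qed.

Let S_le n w : S n w <= n%:R * M.
Proof.
rewrite mulr_natl -[X in M *+ X]card_ord -sumr_const.
by apply: ler_sum => k _; exact: fM.
Qed.

Let iZ k : P.-integrable [set: T] (EFin \o Z k).
Proof.
by apply: (@bounded_integrable _ _ _ _ _ M) => // w; rewrite ger0_norm.
Qed.

Let iZ2 k : P.-integrable [set: T] (EFin \o (fun w => Z k w ^+ 2)).
Proof.
apply: (@bounded_integrable _ _ _ _ _ (M ^+ 2)) => [|w].
  exact: measurable_funX.
by rewrite ger0_norm ?sqr_ge0// lerXn2r// ?nnegrE.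
Qed.

Let iS n : P.-integrable [set: T] (EFin \o S n).
Proof.
by apply: (@bounded_integrable _ _ _ _ _ (n%:R * M)) => // w; rewrite ger0_norm.
Qed.

Let iS2 n : P.-integrable [set: T] (EFin \o (fun w => S n w ^+ 2)).
Proof.
apply: (@bounded_integrable _ _ _ _ _ ((n%:R * M) ^+ 2)) => [|w].
  exact: measurable_funX.
by rewrite ger0_norm ?sqr_ge0//; apply: lerXn2r; rewrite ?nnegrE ?mulr_ge0.
Qed.

Let iSZ n k : P.-integrable [set: T] (EFin \o (fun w => S n w * Z k w)).
Proof.
apply: (@bounded_integrable _ _ _ _ _ ((n%:R * M) * M)) => [|w].
  exact: measurable_funM.
by rewrite ger0_norm ?mulr_ge0// ler_pM.
Qed.

Let iZZ j k : P.-integrable [set: T] (EFin \o (fun w => Z j w * Z k w)).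
Proof.
apply: (@bounded_integrable _ _ _ _ _ (M * M)) => [|w].
  exact: measurable_funM.
by rewrite ger0_norm ?mulr_ge0// ler_pM.
Qed.

Let EZ k : \int[P]_w Z k w = m.
Proof. by congr fine; apply: (integral_ident X_iid). Qed.

Let EZ2 k : \int[P]_w (Z k w ^+ 2) = \int[P]_w (Z 0%N w ^+ 2).
Proof.
congr fine; apply: (@integral_ident _ _ _ _ _ X_iid k (fun x => f x ^+ 2)).
  exact: measurable_funX.
by move=> x; exact: sqr_ge0.
Qed.

Let EZZ j k : j != k -> \int[P]_w (Z j w * Z k w) = m ^+ 2.
Proof.
move=> jk; rewrite /Rintegral (integral_pairwise_mul X_iid jk mf f0 mf f0).
rewrite fineM; last 2 first.
- exact: (integrable_fin_num _ (iZ j)).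
- exact: (integrable_fin_num _ (iZ k)).
by rewrite -!/(Rintegral _ _ _) (EZ j) (EZ k) expr2.
Qed.

Let E0 : \int[P]_w (0 : R) = 0.
Proof. by rewrite Rintegral_cst// mul0r. Qed.

Let ES n : \int[P]_w S n w = n%:R * m.
Proof.
elim: n => [|n IH].
  rewrite mul0r -[RHS]E0.
  by apply: eq_Rintegral => w _; rewrite /S big_ord0.
have -> : \int[P]_w S n.+1 w = \int[P]_w (S n w + Z n w).
  by apply: eq_Rintegral => w _; rewrite /S big_ord_recr.
by rewrite RintegralD// IH EZ -natr1 mulrDl mul1r.
Qed.

Let ESZ n k : (n <= k)%N -> \int[P]_w (S n w * Z k w) = n%:R * m ^+ 2.
Proof.
elim: n => [_|n IH nk].
  rewrite mul0r -[RHS]E0.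
  by apply: eq_Rintegral => w _; rewrite /S big_ord0 mul0r.
have -> : \int[P]_w (S n.+1 w * Z k w) =
    \int[P]_w (S n w * Z k w + Z n w * Z k w).
  by apply: eq_Rintegral => w _; rewrite /S big_ord_recr mulrDl.
rewrite RintegralD// (IH (ltnW nk)) EZZ ?ltn_eqF//.
by rewrite -natr1 mulrDl mul1r.
Qed.

(* By induction on [n]: each new term contributes its own second moment, and
   [2 * n * m ^+ 2] through its products with the previous ones. *)
Let ES2 n : \int[P]_w (S n w ^+ 2) =
  n%:R * \int[P]_w (Z 0%N w ^+ 2) + (n%:R ^+ 2 - n%:R) * m ^+ 2.
Proof.
elim: n => [|n IH].
  rewrite expr0n/= subr0 !mul0r addr0.
  rewrite -[RHS]E0.
  by apply: eq_Rintegral => w _; rewrite /S big_ord0 expr0n.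
have -> : \int[P]_w (S n.+1 w ^+ 2) =
  \int[P]_w ((S n w ^+ 2 + 2 * (S n w * Z n w)) + Z n w ^+ 2).
  by apply: eq_Rintegral => w _; rewrite /S big_ord_recr/= -/(S _ _); ring.
have i2 : P.-integrable [set: T] (EFin \o (fun w => 2 * (S n w * Z n w))).
  exact: (integrableZl measurableT 2 (iSZ n n)).
rewrite RintegralD//; last first.
  exact: (integrableD measurableT (iS2 n) i2).
rewrite RintegralD// RintegralZl// IH ESZ// EZ2 -natr1; ring.
Qed.

(** The cross terms of the second moment vanish by pairwise independence, which
    leaves [n] times the variance of one term. *)
Lemma variance_sum_le n :
  (\int[P]_w ((\sum_(k < n) f (X k w) - n%:R * m) ^+ 2)%:E <=
   n%:R%:E * \int[P]_w (f (X 0%N w) ^+ 2)%:E)%E.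
Proof.
have i1 : P.-integrable [set: T] (EFin \o (fun w => (2 * (n%:R * m)) * S n w)).
  exact: (integrableZl measurableT (2 * (n%:R * m)) (iS n)).
have i2 : P.-integrable [set: T]
    (EFin \o (fun w => S n w ^+ 2 - (2 * (n%:R * m)) * S n w)).
  exact: (integrableB measurableT (iS2 n) i1).
have i3 : P.-integrable [set: T] (EFin \o (fun=> (n%:R * m) ^+ 2)).
  by apply: (@bounded_integrable _ _ _ _ _ `|(n%:R * m) ^+ 2|).
have i4 : P.-integrable [set: T]
    (EFin \o (fun w => (S n w - n%:R * m) ^+ 2)).
  rewrite (_ : (fun w => _) = (fun w =>
      (S n w ^+ 2 - (2 * (n%:R * m)) * S n w) + (n%:R * m) ^+ 2)).
    exact: (integrableD measurableT i2 i3).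
  by apply/funext => w; ring.
rewrite -[X in (X <= _)%E]fineK; last exact: (integrable_fin_num _ i4).
rewrite -[X in (_ * X)%E]fineK; last exact: (integrable_fin_num _ (iZ2 0%N)).
rewrite -EFinM lee_fin.
rewrite -!/(Rintegral _ _ _).
have -> : \int[P]_w ((S n w - n%:R * m) ^+ 2) =
   \int[P]_w ((S n w ^+ 2 - (2 * (n%:R * m)) * S n w) + (n%:R * m) ^+ 2).
  by apply: eq_Rintegral => w _; ring.
rewrite RintegralD// RintegralB// RintegralZl// ES2 ES Rintegral_cst//.
rewrite [fine _](_ : _ = 1) ?mulr1; last exact: (congr1 fine (probability_setT P)).
rewrite -subr_ge0 [X in 0 <= X](_ : _ = n%:R * m ^+ 2); last by rewrite /Z; ring.
by rewrite mulr_ge0// sqr_ge0.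
Qed.

End SecondMoment.

(** * Geometrically growing times *)

(** Integers starting at [p] whose successive ratios lie between [1 + 1 / p] and
    [1 + 2 / p]: they grow geometrically, which makes the sums below converge,
    yet slowly enough for averages to be controlled between two of them. *)
Definition block (p n : nat) : nat := iter n (fun K => K + (K %/ p).+1)%N p.

Lemma block_ltnS p n : (block p n < block p n.+1)%N.
Proof. by rewrite /block iterS -addn1 leq_add2l. Qed.

Lemma leq_block p : {homo block p : m n / (m <= n)%N}.
Proof.
by apply: homo_leq => //; [exact: leq_trans|move=> n; exact/ltnW/block_ltnS].
Qed.

Lemma block_ge p n : (p <= block p n)%N.
Proof. exact: (@leq_block p 0%N n). Qed.

Lemma block_gt0 p n : (0 < p)%N -> (0 < block p n)%N.
Proof. by move=> p0; exact: leq_trans (block_ge p n). Qed.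

Lemma block_geid p n : (n <= block p n)%N.
Proof. by elim: n => // n IH; exact: leq_ltn_trans (block_ltnS p n). Qed.

Lemma block_growth (R : realType) p n : (0 < p)%N ->
  (block p n)%:R <= p%:R * ((block p n.+1)%:R - (block p n)%:R) :> R.
Proof.
move=> p0; rewrite /block iterS -/(block p n) natrD addrAC subrr add0r.
by rewrite -natrM ler_nat mulnC ltnW// ltn_ceil.
Qed.

Lemma block_ratio (R : realType) p n : (0 < p)%N ->
  (block p n.+1)%:R <= (1 + 2 / p%:R) * (block p n)%:R :> R.
Proof.
move=> p0; have p0' : 0 < p%:R :> R by rewrite ltr0n.
rewrite -(ler_pM2l p0') mulrA mulrDr mulr1 mulrCA divff ?gt_eqF// mulr1.
rewrite -natrD -!natrM ler_nat /block iterS -/(block p n).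
have := leq_divM (block p n) p; have := block_ge p n; lia.
Qed.

Section GeometricSums.
Context (R : realType) (K : nat -> R) (c : R).
Hypotheses (K0 : forall n, 0 < K n) (c0 : 0 <= c)
  (Kc : forall n, K n <= c * (K n.+1 - K n)).

(** A geometric sum is comparable to its last term, and the last term counted
    here is below [y]. *)
Lemma sum_below y N : 0 <= y ->
  \sum_(n < N) (if K n < y then K n else 0) <= (c + 1) * y.
Proof.
move=> y0; elim: N => [|N IH]; first by rewrite big_ord0 mulr_ge0// addr_ge0.
rewrite big_ord_recr/=; case: ifPn => [KNy|_]; last by rewrite addr0.
have sumK M : \sum_(n < M) K n <= c * K M.
  elim: M => [|M IHM]; first by rewrite big_ord0 mulr_ge0// ltW.
  by rewrite big_ord_recr/=; have := Kc M; lra.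
have : \sum_(n < N) (if K n < y then K n else 0) <= \sum_(n < N) K n.
  by apply: ler_sum => n _; case: ifP => // _; exact: ltW.
by have := sumK N; have := ler_wpM2l c0 (ltW KNy); lra.
Qed.

(** A decreasing geometric sum is comparable to its first term, which is at most
    [y ^+ 2 / y]. The sum of [1 / K n] telescopes up to the factor [c + 1]; the
    maximum in the induction handles the indices with [K n < y]. *)
Lemma sum_above y N : 0 <= y ->
  \sum_(n < N) (if K n < y then 0 else y ^+ 2 / K n) <= (c + 1) * y.
Proof.
move=> y0.
have step n : y ^+ 2 / K n <= (c + 1) * (y ^+ 2 / K n - y ^+ 2 / K n.+1).
  rewrite -!mulrBr mulrCA ler_wpM2l ?sqr_ge0//.
  have : (c + 1) * (K n.+1)^-1 <= c * (K n)^-1.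
    rewrite ler_pdivlMr// mulrAC ler_pdivrMr//.
    by have := Kc n; lra.
  lra.
suff : \sum_(n < N) (if K n < y then 0 else y ^+ 2 / K n) <=
    (c + 1) * Num.max 0 (y - y ^+ 2 / K N).
  move=> /le_trans; apply; rewrite ler_wpM2l// ?addr_ge0// ge_max y0/=.
  by rewrite lerBlDr lerDl divr_ge0 ?sqr_ge0// ltW.
elim: N => [|N IH].
  by rewrite big_ord0 mulr_ge0 ?addr_ge0// le_max lexx.
rewrite big_ord_recr/=; case: ifPn => [KNy|].
  rewrite addr0 (le_trans IH)// ler_wpM2l ?addr_ge0// ge_max !le_max lexx/=.
  apply/orP; left; rewrite subr_le0 ler_pdivlMr// expr2 ler_wpM2l//.
  exact: ltW.
rewrite -leNgt => yKN.
have -> : Num.max 0 (y - y ^+ 2 / K N.+1) = y - y ^+ 2 / K N.+1.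
  apply/max_idPr; rewrite subr_ge0 ler_pdivrMr// expr2 ler_wpM2l//.
  rewrite (le_trans yKN)//.
  have := Kc N; have := K0 N => KN0 h.
  rewrite leNgt; apply/negP => /ltW KN.
  have : c * (K N.+1 - K N) <= 0 by rewrite mulr_ge0_le0// subr_le0.
  lra.
have KNE : Num.max 0 (y - y ^+ 2 / K N) = y - y ^+ 2 / K N.
  by apply/max_idPr; rewrite subr_ge0 ler_pdivrMr// expr2 ler_wpM2l.
rewrite KNE in IH.
by have := step N; lra.
Qed.

End GeometricSums.

(** * The strong law of large numbers *)

Definition mean (R : realType) (Y : nat -> R) (n : nat) : R :=
  n%:R^-1 * \sum_(k < n) Y k.

Section BlockLLN.
Context (d : measure_display) (T : measurableType d) (R : realType)
  (P : probability T R) (X : nat -> {RV P >-> R}).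
Hypothesis X_iid : pairwise_iid X.
Variable f : R -> R.
Hypotheses (mf : measurable_fun [set: R] f) (f0 : forall x, 0 <= f x)
  (f_int : P.-integrable [set: T] (EFin \o (fun w => f (X 0%N w)))).

(* In the sum of the first [K] terms, all of them are truncated at the same level
   [K], while Etemadi's original argument truncates the [k]-th one at [k]: here
   the truncated terms are identically distributed, and summing over the values
   [block p n] of [K] only involves geometric sums. *)
Let trunc (K x : R) : R := Num.min (f x) K.

Let mtrunc K : measurable_fun [set: R] (trunc K).
Proof. exact: measurable_minr. Qed.

Let trunc_ge0 (K : R) x : 0 <= K -> 0 <= trunc K x.
Proof. by move=> K0; rewrite le_min f0. Qed.

Let trunc_le K x : trunc K x <= K.
Proof. by rewrite ge_min lexx orbT. Qed.

Let over (K : R) : set R := f @^-1` `]K, +oo[.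

Let mover K : measurable (over K).
Proof. by rewrite -[over K]setTI; exact: mf. Qed.

Let overE K x : (\1_(over K) x : R) = (K < f x)%R%:R.
Proof.
rewrite indicE; congr (_%:R); congr nat_of_bool.
by apply/idP/idP; rewrite inE /over/= in_itv/= andbT.
Qed.

Let m (K : R) := \int[P]_w trunc K (X 0%N w).

Let mean_trunc_cvg (K : nat -> nat) : (forall n, n <= K n)%N ->
  m (K n)%:R @[n --> \oo] --> \int[P]_w f (X 0%N w).
Proof.
move=> nK.
have /fine_cvgP[_] // :
    (\int[P]_w (trunc (K n)%:R (X 0%N w))%:E @[n --> \oo] -->
    (\int[P]_w f (X 0%N w))%:E)%E.
rewrite fineK; last exact: (integrable_fin_num _ f_int).
apply: (@dominated_cvg _ _ _ _ _ measurableT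
   (fun n w => (trunc (K n)%:R (X 0%N w))%:E)
   (fun w => (f (X 0%N w))%:E) (fun w => (f (X 0%N w))%:E)) => //.
- by move=> n; apply/measurable_EFinP; exact: measurableT_comp.
- move=> w _; apply: cvg_near_cst.
  exists (Num.truncn (f (X 0%N w))).+1 => // n /= tn.
  congr (_%:E); apply/min_idPl.
  apply: (le_trans (ltW (Num.Theory.truncnS_gt _))); rewrite ler_nat.
  exact: leq_trans tn (nK n).
- move=> n w _; rewrite /= lee_fin ger0_norm ?trunc_ge0//.
  by rewrite ge_min lexx.
Qed.

Let S (n : nat) w := \sum_(k < n) f (X k w).

(* [D n] being small controls both the fluctuation of the truncated sum and,
   since [exceed n] is integer-valued, the effect of the truncation, which is
   absent as soon as [exceed n < 1]. *)
Let dev (n : nat) w := (\sum_(k < n) trunc n%:R (X k w) - n%:R * m n%:R) ^+ 2.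
Let exceed (n : nat) w : R := \sum_(k < n) \1_(over n%:R) (X k w).

Let D (n : nat) w := (n%:R ^+ 2)^-1 * dev n w + exceed n w.

Let mdev n : measurable_fun [set: T] (dev n).
Proof.
apply: measurable_funX; apply: measurable_funB => //.
by apply: measurable_sum => k; exact: measurableT_comp.
Qed.

Let mexceed n : measurable_fun [set: T] (exceed n).
Proof.
apply: measurable_sum => k; apply: measurableT_comp => //.
Qed.

Let exceed_ge0 n w : 0 <= exceed n w.
Proof. by apply: sumr_ge0 => k _; rewrite overE. Qed.

Let D_ge0 n w : 0 <= D n w.
Proof. by rewrite addr_ge0// mulr_ge0 ?invr_ge0 ?sqr_ge0. Qed.

(* The value at [y = f (X 0)] of the terms that bound the expectation of [D n];
   its sum over the values [block p i] of [n] is at most a constant times [y]. *)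
Let phi (n : nat) (y : R) : R :=
  2 * (if n%:R < y then n%:R else 0) + (if n%:R < y then 0 else y ^+ 2 / n%:R).

Let integral_D_le n : (0 < n)%N ->
  (\int[P]_w (D n w)%:E <= \int[P]_w (phi n (f (X 0%N w)))%:E)%E.
Proof.
move=> n0.
have n0' : 0 < n%:R :> R by rewrite ltr0n.
pose t2 w : R := trunc n%:R (X 0%N w) ^+ 2.
pose o w : R := \1_(over n%:R) (X 0%N w).
have mt2 : measurable_fun [set: T] (EFin \o t2).
  by apply/measurable_EFinP; apply: measurable_funX; exact: measurableT_comp.
have mo k : measurable_fun [set: T]
    (fun w => (\1_(over n%:R) (X k w))%:E : \bar R).
  apply/measurable_EFinP; apply: measurableT_comp => //.
have t2_ge0 w : (0 <= (t2 w)%:E)%E by rewrite lee_fin sqr_ge0.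
have o_ge0 k w : (0 <= (\1_(over n%:R) (X k w))%:E :> \bar R)%E.
  by rewrite lee_fin overE.
have mo0 : measurable_fun [set: T] (EFin \o o) by exact: mo.
have o0_ge0 w : (0 <= (o w)%:E)%E by exact: o_ge0.
have n_ge0 : (0 <= n%:R^-1 :> R) by rewrite invr_ge0.
have -> : (\int[P]_w (phi n (f (X 0%N w)))%:E =
    (n%:R^-1)%:E * \int[P]_w (t2 w)%:E + n%:R%:E * \int[P]_w (o w)%:E)%E.
  rewrite -ge0_integralZl_EFin// -ge0_integralZl_EFin//.
  rewrite -ge0_integralD//=; last 4 first.
  - by move=> w _; rewrite mule_ge0.
  - exact: measurable_funeM.
  - by move=> w _; rewrite mule_ge0.
  - exact: measurable_funeM.
  apply: eq_integral => w _; rewrite -!EFinM -EFinD /o overE /phi /t2 /trunc.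
  congr (_%:E); case: ltP => [lt|le].
    by rewrite mulr1 addr0 expr2 mulKf ?gt_eqF//; ring.
  by rewrite !mulr0 addr0 add0r mulrC.
have dev_ge0 w : (0 <= (dev n w)%:E)%E by rewrite lee_fin sqr_ge0.
have mdevE : measurable_fun [set: T] (EFin \o dev n) by exact/measurable_EFinP.
have n2_ge0 : 0 <= (n%:R ^+ 2)^-1 :> R by rewrite invr_ge0 sqr_ge0.
rewrite /D; under eq_integral do rewrite EFinD EFinM.
rewrite ge0_integralD//=; last 4 first.
- by move=> w _; rewrite mule_ge0.
- exact: measurable_funeM.
- by move=> w _; rewrite lee_fin.
- exact/measurable_EFinP.
rewrite ge0_integralZl_EFin//.
apply: leeD.
  have := @variance_sum_le _ _ _ _ _ X_iid (trunc n%:R) n%:R (mtrunc _)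
    (fun x => trunc_ge0 x (ltW n0')) (trunc_le _) n.
  rewrite -/(m n%:R) -/(dev n _) => h.
  apply: (le_trans (lee_wpmul2l _ h)); first by rewrite lee_fin.
  rewrite muleA -EFinM lee_wpmul2r//.
    by apply: integral_ge0 => w _; exact: t2_ge0.
  by rewrite lee_fin expr2 invfM -mulrA mulVf ?gt_eqF// mulr1.
rewrite /exceed; under eq_integral do rewrite -sumEFin.
rewrite ge0_integral_sum//=.
rewrite (eq_bigr (fun=> \int[P]_w (o w)%:E)%E).
  by rewrite mule_natl sumr_const card_ord.
move=> k _; apply: (integral_ident X_iid) => //.
Qed.

(** The expectations of [D] at the block ends are summable since [f (X 0)] is
    integrable, so that [D] tends to 0 almost surely. *)
Lemma block_lln p : (0 < p)%N ->
  {ae P, forall w, (block p n)%:R^-1 * S (block p n) w @[n --> \oo]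
     --> \int[P]_w f (X 0%N w)}.
Proof.
move=> p0.
have K0 n : 0 < (block p n)%:R :> R by rewrite ltr0n block_gt0.
pose c : R := p%:R.
have c0 : 0 <= c by rewrite ler0n.
have phi_sum N y : 0 <= y -> \sum_(n < N) phi (block p n) y <= 3 * (c + 1) * y.
  move=> y0; rewrite big_split/= -mulr_sumr.
  have := sum_below K0 c0 (fun n => block_growth R n p0) N y0.
  have := sum_above K0 c0 (fun n => block_growth R n p0) N y0.
  lra.
have phi_ge0 n y : 0 <= phi n y.
  have y2n : 0 <= y ^+ 2 / n%:R by apply: divr_ge0 => //; exact: sqr_ge0.
  by rewrite /phi; case: (_ < y); rewrite addr_ge0// mulr_ge0.
have mphi n : measurable_fun [set: R] (fun x => phi n (f x)).
  apply: measurable_funD.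
    apply: measurable_funM => //; apply: measurable_fun_ifT => //.
    exact: measurable_fun_ltr.
  apply: measurable_fun_ifT => //; first exact: measurable_fun_ltr.
  by apply: measurable_funM => //; exact: measurable_funX.
have summ N : (\sum_(0 <= n < N) \int[P]_w (D (block p n) w)%:E <=
    (3 * (c + 1) * \int[P]_w f (X 0%N w))%:E)%E.
  apply: (@le_trans _ _
      (\sum_(0 <= n < N) \int[P]_w (phi (block p n) (f (X 0%N w)))%:E)%E).
    by apply: lee_sum => n _; apply: integral_D_le; exact: block_gt0.
  rewrite -ge0_integral_sum//=; last 2 first.
  - by move=> n; apply/measurable_EFinP; exact: (measurableT_comp (mphi _)).
  - by move=> n w _; rewrite lee_fin.
  rewrite EFinM fineK; last exact: (integrable_fin_num _ f_int).
  rewrite -ge0_integralZl//=; last 3 first.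
  - by apply/measurable_EFinP; exact: measurableT_comp.
  - by move=> w _; rewrite lee_fin.
  - by rewrite lee_fin mulr_ge0// addr_ge0.
  apply: ge0_le_integral => //=.
  - by move=> w _; rewrite sumEFin lee_fin sumr_ge0.
  - apply: emeasurable_sum => n; apply/measurable_EFinP.
    exact: (measurableT_comp (mphi _)).
  - apply/measurable_EFinP; apply: measurable_funM => //.
    exact: measurableT_comp.
  - by move=> w _; rewrite sumEFin -EFinM lee_fin big_mkord phi_sum.
have mD n : measurable_fun [set: T] (D n).
  by apply: measurable_funD => //; exact: measurable_funM.
apply: filterS (ae_cvg0_summable (fun n => mD (block p n))
  (fun n w => D_ge0 _ w) summ).
move=> w Dw.
have dev0 : (block p n)%:R^-1 * S (block p n) w - m (block p n)%:R
    @[n --> \oo] --> (0 : R).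
  apply/cvgr0Pnorm_le => e e0.
  have /cvgr0Pnorm_lt/(_ (Num.min 1 (e ^+ 2))) := Dw.
  rewrite lt_min ltr01 exprn_gt0// => /(_ isT).
  apply: filterS => n; set K := block p n.
  rewrite ger0_norm ?D_ge0// lt_min => /andP[D1 De].
  have sq_ge0 : 0 <= (K%:R ^+ 2)^-1 * dev K w.
    by rewrite mulr_ge0 ?invr_ge0 ?sqr_ge0.
  have E1 : exceed K w < 1 by rewrite (le_lt_trans _ D1)// lerDr.
  have no_exceed (k : 'I_K) : f (X k w) <= K%:R.
    rewrite leNgt; apply/negP => lt; move: E1; rewrite ltNge => /negP; apply.
    rewrite /exceed (bigD1 k)//= overE lt lerDl.
    by apply: sumr_ge0 => j _; rewrite overE.
  have SE : \sum_(k < K) trunc K%:R (X k w) = S K w.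
    by apply: eq_bigr => k _; apply/min_idPl; exact: no_exceed.
  have := K0 n; rewrite -/K => K0n.
  have devE : (K%:R ^+ 2)^-1 * dev K w = (K%:R^-1 * S K w - m K%:R) ^+ 2.
    by rewrite /dev SE; field; rewrite gt_eqF.
  rewrite -(@ler_pXn2r _ 2)// ?nnegrE ?(ltW e0)// real_normK ?num_real// -devE.
  by rewrite ltW// (le_lt_trans _ De)// lerDl.
rewrite -[X in _ --> X]add0r.
rewrite (_ : (fun n => _) = (fun n =>
    ((block p n)%:R^-1 * S (block p n) w - m (block p n)%:R) +
    m (block p n)%:R)).
  by apply: cvgD => //; apply: mean_trunc_cvg; exact: block_geid.
by apply/funext => n; rewrite subrK.
Qed.

End BlockLLN.

(** Between two consecutive block ends, monotonicity of [S] costs a factor of at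
    most [1 + 2 / p] on either side, and [p] is arbitrary. *)
Lemma cvg_mean_of_blocks (R : realType) (S : nat -> R) (mu : R) :
  {homo S : m n / (m <= n)%N >-> m <= n} -> 0 <= S 0%N -> 0 <= mu ->
  (forall p, (0 < p)%N ->
     (block p n)%:R^-1 * S (block p n) @[n --> \oo] --> mu) ->
  n%:R^-1 * S n @[n --> \oo] --> mu.
Proof.
move=> S_nd S0 mu0 S_block; apply/cvgrPdist_le => e e0.
have Sge0 n : 0 <= S n by rewrite (le_trans S0)// S_nd.
(* Large enough for [2 / p * (mu + 1)] to be at most [e / 2]. *)
pose p := (Num.truncn (4 * (mu + 1) / e)).+1.
have p0 : (0 < p)%N by [].
have p0' : 0 < p%:R :> R by rewrite ltr0n.
pose t : R := 2 / p%:R.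
have t0 : 0 <= t by rewrite divr_ge0.
have tmu : t * (mu + 1) <= e / 2.
  have : 4 * (mu + 1) / e < p%:R by exact: Num.Theory.truncnS_gt.
  rewrite ltr_pdivrMr// => h.
  by rewrite /t mulrAC ler_pdivrMr//; lra.
pose dl : R := Num.min (e / 2) 1.
have dl0 : 0 < dl by rewrite lt_min ltr01 divr_gt0.
have dle : dl <= e / 2 by rewrite ge_min lexx.
have dl1 : dl <= 1 by rewrite ge_min lexx orbT.
have /cvgrPdist_le/(_ _ dl0)[N _ near_mu] := S_block p p0.
have block_bounds n : (N <= n)%N ->
    (mu - dl) * (block p n)%:R <= S (block p n) <= (mu + dl) * (block p n)%:R.
  move=> Nn; have := near_mu n Nn; rewrite /= distrC ler_distl.
  have Kn0 : 0 < (block p n)%:R :> R by rewrite ltr0n block_gt0.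
  by rewrite mulrC ler_pdivlMr// ler_pdivrMr.
exists (block p N) => // m /= Nm.
have m0 : 0 < m%:R :> R by rewrite ltr0n (leq_trans _ Nm)// block_gt0.
have exK : exists n, (block p n <= m)%N by exists N.
have ubK n : (block p n <= m)%N -> (n <= m)%N.
  exact: leq_trans (block_geid p n).
case: (ex_maxnP exK ubK) => n Km maxn.
have Nn : (N <= n)%N by exact: maxn.
have mK : (m <= block p n.+1)%N.
  by rewrite leqNgt; apply/negP => /ltnW/maxn; rewrite ltnn.
have /andP[aA _] := block_bounds n Nn.
have /andP[_ bB] := block_bounds n.+1 (leqW Nn).
have ratio := block_ratio R n p0.
have ax := S_nd _ _ Km; have xb := S_nd _ _ mK.
have Am : (block p n)%:R <= m%:R :> R by rewrite ler_nat.
have mB : m%:R <= (block p n.+1)%:R :> R by rewrite ler_nat.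
move: ratio aA bB ax xb Am mB; rewrite -/t.
move: (block p n)%:R (block p n.+1)%:R (S (block p n)) (S (block p n.+1))
  (S m) (Sge0 m).
move=> A B a b x x0 ratio aA bB ax xb Am mB.
rewrite distrC ler_distl mulrC ler_pdivlMr// ler_pdivrMr//.
apply/andP; split.
  have [le|gt] := leP (mu - e) 0.
    by rewrite (le_trans _ x0)// mulr_le0_ge0// ltW.
  have h1 : (mu - e) * m%:R <= (mu - e) * ((1 + t) * A).
    by rewrite ler_wpM2l ?(ltW gt)// (le_trans mB).
  have h2 : t * (mu - e) <= t * (mu + 1) by rewrite ler_wpM2l//; lra.
  have A0 : 0 <= A.
    rewrite leNgt; apply/negP => A0.
    by have := mulr_ge0_le0 (addr_ge0 ler01 t0) (ltW A0); lra.
  have h3 : (mu - e) * (1 + t) * A <= (mu - dl) * A by rewrite ler_wpM2r//; lra.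
  lra.
have h1 : (mu + dl) * B <= (mu + dl) * ((1 + t) * m%:R).
  rewrite ler_wpM2l//; first by rewrite addr_ge0// ltW.
  by rewrite (le_trans ratio)// ler_wpM2l// addr_ge0.
have h2 : t * (mu + dl) <= t * (mu + 1) by rewrite ler_wpM2l//; lra.
have h3 : (mu + dl) * (1 + t) * m%:R <= (mu + e) * m%:R.
  by rewrite ler_wpM2r ?(ltW m0)//; lra.
lra.
Qed.

Section StrongLaw.
Context (d : measure_display) (T : measurableType d) (R : realType)
  (P : probability T R) (X : nat -> {RV P >-> R}).
Hypothesis X_iid : pairwise_iid X.

(** Etemadi's strong law of large numbers, in which pairwise independence is
    enough. Nonnegativity makes the partial sums monotone, as needed to
    interpolate between block ends. *)
Lemma strong_law_ge0 (f : R -> R) : measurable_fun [set: R] f ->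
  (forall x, 0 <= f x) ->
  P.-integrable [set: T] (EFin \o (fun w => f (X 0%N w))) ->
  {ae P, forall w, mean (fun k => f (X k w)) n @[n --> \oo]
     --> \int[P]_w f (X 0%N w)}.
Proof.
move=> mf f0 f_int.
have blocks p := block_lln X_iid mf f0 f_int (ltn0Sn p).
apply: filterS (ae_foralln blocks) => w blocks_w.
apply: (@cvg_mean_of_blocks _ (fun n => \sum_(k < n) f (X k w))).
- move=> m n mn; rewrite -!(big_mkord xpredT (fun k => f (X k w))).
  by rewrite (big_cat_nat _ mn)//= lerDl sumr_ge0.
- by rewrite big_ord0.
- by apply: Rintegral_ge0 => v _; exact: f0.
- by case=> // p _; exact: blocks_w.
Qed.

Lemma strong_law (f : R -> R) : measurable_fun [set: R] f ->
  P.-integrable [set: T] (EFin \o (fun w => f (X 0%N w))) ->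
  {ae P, forall w, mean (fun k => f (X k w)) n @[n --> \oo]
     --> \int[P]_w f (X 0%N w)}.
Proof.
move=> mf f_int.
have part (g : R -> R) :
    measurable_fun [set: R] g -> (forall x, `|g x| <= `|f x|) ->
    P.-integrable [set: T] (EFin \o (fun w => g (X 0%N w))).
  move=> mg gf; apply: le_integrable f_int => //.
    by apply/measurable_EFinP; exact: measurableT_comp.
  by move=> w _ /=; rewrite lee_fin gf.
pose fp x : R := Num.max (f x) 0; pose fn x : R := Num.max (- f x) 0.
have fE x : f x = fp x - fn x.
  by rewrite /fp /fn; case: (leP (f x) 0); case: (leP (- f x) 0); lra.
have mfp : measurable_fun [set: R] fp by exact: measurable_maxr.
have mfn : measurable_fun [set: R] fn.
  by apply: measurable_maxr => //; exact: measurableT_comp.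
have fp0 x : 0 <= fp x by rewrite le_max lexx orbT.
have fn0 x : 0 <= fn x by rewrite le_max lexx orbT.
have ip : P.-integrable [set: T] (EFin \o (fun w => fp (X 0%N w))).
  by apply: part => // x; rewrite ger0_norm// ge_max ler_norm normr_ge0.
have iq : P.-integrable [set: T] (EFin \o (fun w => fn (X 0%N w))).
  by apply: part => // x; rewrite ger0_norm// ge_max -normrN ler_norm normr_ge0.
apply: filterS2 (strong_law_ge0 mfp fp0 ip) (strong_law_ge0 mfn fn0 iq).
move=> w Hp Hn.
have -> : \int[P]_w f (X 0%N w) =
    \int[P]_w fp (X 0%N w) - \int[P]_w fn (X 0%N w).
  by rewrite -RintegralB//; apply: eq_Rintegral => v _; exact: fE.
rewrite (_ : mean _ = (fun n => mean (fun k => fp (X k w)) n -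
    mean (fun k => fn (X k w)) n)); first exact: cvgB.
apply/funext => n; rewrite /mean -mulrBr -sumrB; congr (_ * _).
by apply: eq_bigr => k _; exact: fE.
Qed.

End StrongLaw.

(** * Implicit recursions along one path *)

(** Above [eps], the corrected sequence [s n - a n] decreases by at least a
    constant multiple of [1 / n]. As the harmonic series diverges, [s] must
    come down to [eps]. After such a visit, [s n - a n] is essentially at most
    [eps - mu], and it can leave this range neither while [s] is above [eps],
    since it decreases, nor when [s] is at most [eps]. *)
Lemma drift_eventually_le (R : realType) (a s : nat -> R) (mu eps : R) :
  a n @[n --> \oo] --> mu -> mu < 0 ->
  (\forall n \near \oo, eps < s n.+1 ->
     s n.+1 - a n.+1 <= s n - a n + n.+1%:R^-1 * a n) ->
  forall delta, 0 < delta -> \forall n \near \oo, s n <= eps + delta.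
Proof.
move=> a_mu mu0 s_step dl dl0.
have dl2 : 0 < dl / 2 by rewrite divr_gt0.
have mu2 : 0 < - mu / 2 by rewrite divr_gt0// oppr_gt0.
have a_near : \forall n \near \oo, `|mu - a n| <= dl / 2.
  by move/cvgrPdist_le : a_mu; apply.
have a_neg : \forall n \near \oo, `|mu - a n| <= - mu / 2.
  by move/cvgrPdist_le : a_mu; apply.
have [N _ HN] : \forall n \near \oo, [/\ `|mu - a n| <= dl / 2,
    `|mu - a n| <= - mu / 2 & (eps < s n.+1 ->
     s n.+1 - a n.+1 <= s n - a n + n.+1%:R^-1 * a n)].
  by near=> n; split; near: n.
have a_bounds n : (N <= n)%N -> [/\ mu - dl / 2 <= a n, a n <= mu + dl / 2 &
    a n <= mu / 2].
  move=> /HN[]; rewrite !(distrC mu) !ler_distl => /andP[? ?] /andP[? ?] _.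
  by split=> //; lra.
(* If [s] never came down to [eps], the harmonic series would be bounded. *)
have [j Nj sj] : exists2 j, (N <= j)%N & s j <= eps.
  apply: contrapT => no_visit.
  have above n : (N <= n)%N -> eps < s n.
    by move=> Nn; rewrite ltNge; apply/negP => sn; apply: no_visit; exists n.
  have descent i : s (N + i)%N - a (N + i)%N <=
      s N - a N + mu / 2 * (series harmonic (N + i)%N - series harmonic N).
    elim: i => [|i IH]; first by rewrite addn0 subrr mulr0 addr0.
    have Ni : (N <= N + i)%N by rewrite leq_addr.
    have [_ _ /(_ _)] := HN _ Ni.
    rewrite -addnS => /(_ (above _ (leq_addr _ _))).
    have [_ _ aNi] := a_bounds _ Ni.
    have -> : series (@harmonic R) (N + i.+1)%N =
        series harmonic (N + i)%N + (N + i).+1%:R^-1.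
      by rewrite addnS /series/= big_nat_recr.
    have : (N + i).+1%:R^-1 * a (N + i)%N <= (N + i).+1%:R^-1 * (mu / 2).
      by rewrite ler_wpM2l// invr_ge0.
    rewrite addnS; move: ((N + i).+1%:R^-1) => q.
    have -> H : mu / 2 * (H + q - series harmonic N) =
        mu / 2 * (H - series harmonic N) + q * (mu / 2) by ring.
    lra.
  apply: (@dvg_harmonic R); apply: nondecreasing_is_cvgn.
    apply/nondecreasing_seqP => n; rewrite /series/= big_nat_recr//= lerDl.
    by rewrite invr_ge0.
  pose B := series (@harmonic R) N +
    (s N - a N - eps + (mu + dl / 2)) / (- mu / 2).
  exists (Num.max B (series harmonic N)) => _ [n _ <-].
  have [nN|Nn] := leqP n N.
    rewrite le_max; apply/orP; right.
    rewrite /series/= (big_cat_nat _ nN)//= lerDl.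
    by apply: sumr_ge0 => k _; rewrite invr_ge0.
  rewrite le_max; apply/orP; left; rewrite /B -lerBlDl ler_pdivlMr//.
  have -> H : (H - series harmonic N) * (- mu / 2) =
      - (mu / 2 * (H - series harmonic N)) by ring.
  have := descent (n - N)%N; rewrite subnKC ?(ltnW Nn)//.
  have := above _ (ltnW Nn); have [_ h _] := a_bounds _ (ltnW Nn).
  lra.
have inv i : s (j + i)%N - a (j + i)%N <= eps - mu + dl / 2.
  elim: i => [|i IH].
    by rewrite addn0; have [] := a_bounds _ Nj; lra.
  have Nji : (N <= j + i)%N by rewrite (leq_trans Nj)// leq_addr.
  have [b1 b2 b3] := a_bounds _ Nji.
  have [c1 c2 c3] := a_bounds _ (leqW Nji).
  rewrite addnS; have [le|gt] := leP (s (j + i).+1) eps; first by lra.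
  have [_ _ /(_ gt)] := HN _ Nji.
  have : (j + i).+1%:R^-1 * a (j + i)%N <= 0.
    by rewrite mulr_ge0_le0 ?invr_ge0//; lra.
  by move: (_ * a (j + i)%N) => q; lra.
exists j => // n /= jn; have := inv (n - j)%N; rewrite subnKC//.
have [_ b2 _] := a_bounds _ (leq_trans Nj jn).
lra.
Unshelve. all: by end_near. Qed.

(** This identity turns the increments [Y n / n.+1] of a recursion into the
    increments of the mean, plus the drift used in [drift_eventually_le]. *)
Lemma mean_recr (R : realType) (Y : nat -> R) n : (0 < n)%N ->
  mean Y n.+1 - mean Y n + n.+1%:R^-1 * mean Y n = n.+1%:R^-1 * Y n.
Proof.
move=> n0; rewrite /mean big_ord_recr/= -natr1; field.
by rewrite natr1 !pnatr_eq0 -!lt0n n0.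
Qed.

Lemma cvg_mean_last (R : realType) (Y : nat -> R) (mu : R) :
  mean Y n @[n --> \oo] --> mu -> n.+1%:R^-1 * Y n @[n --> \oo] --> (0 : R).
Proof.
move=> Ymu.
have inv0 : (fun n => n.+1%:R^-1 : R) @ \oo --> (0 : R) by exact: cvg_harmonic.
have : mean Y n.+1 - mean Y n + n.+1%:R^-1 * mean Y n @[n --> \oo] -->
    mu - mu + 0 * mu.
  apply: cvgD; last exact: cvgM.
  by apply: cvgB => //; rewrite cvg_shiftS.
rewrite subrr mul0r addr0; apply: cvg_trans; apply: near_eq_cvg.
by exists 1%N => // n /= n0; rewrite mean_recr.
Qed.

(** For injective [phi], this says that the inverse of [phi] is defined near 0 and
    is [z + O(z ^+ 2)] there. The existential form is stable under the reflection
    [fun v => - phi (- v)] and is immediate for the identity. *)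
Definition near_identity_inverse (R : realType) (phi : R -> R) : Prop :=
  exists C delta : R, [/\ 0 < C, 0 < delta &
    forall z, `|z| < delta -> exists2 v, phi v = z & `|v - z| <= C * z ^+ 2].

(** While [s n.+1] exceeds [eps], monotonicity of [h] replaces the unknown
    argument [x n - s n.+1] by [x n - eps]. With [z] the resulting step
    [h (x n - eps) / n.+1], which tends to 0 by the convergence of the means,
    inverting [phi] bounds the increment of [s] by [z + C * z ^+ 2], hence by
    [z + eta * `|z|] for large [n], whatever [eta > 0]. These bounds are the
    terms, divided by [n.+1], of a sequence whose means tend to
    [mu + eta * M], which is negative for small [eta]. *)
Lemma implicit_step_eventually_le (R : realType) (phi h : R -> R)
    (x s : nat -> R) (eps mu M : R) :
  (forall u v, phi u <= phi v -> u <= v) -> near_identity_inverse phi ->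
  (forall u v, u <= v -> h u <= h v) ->
  (\forall n \near \oo,
     phi (s n - s n.+1) = - (n.+1%:R^-1 * h (x n - s n.+1))) ->
  mean (fun n => h (x n - eps)) n @[n --> \oo] --> mu -> mu < 0 ->
  mean (fun n => `|h (x n - eps)|) n @[n --> \oo] --> M ->
  forall delta, 0 < delta -> \forall n \near \oo, s n <= eps + delta.
Proof.
move=> phi_le [C [dl [C0 dl0 phi_inv]]] h_nd s_rec.
set Y := fun n => h (x n - eps) => Ymu mu0 YM.
have M0 : 0 <= M.
  apply: (cvgr_to_ge YM); apply: nearW => n.
  by rewrite mulr_ge0 ?invr_ge0// sumr_ge0.
(* This choice gives [mu + eta * M < mu / 2]. *)
pose eta := - mu / (2 * (M + 1)).
have M1 : 0 < M + 1 by rewrite ltr_wpDl.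
have eta0 : 0 < eta by rewrite divr_gt0 ?oppr_gt0// mulr_gt0.
pose Z n := Y n + eta * `|Y n|.
have meanZ : mean Z = (fun n => mean Y n + eta * mean (fun k => `|Y k|) n).
  apply/funext => n; rewrite /mean /Z big_split/= mulrDr -mulr_sumr; ring.
have Zmu : mean Z n @[n --> \oo] --> mu + eta * M.
  by rewrite meanZ; apply: cvgD => //; exact: cvgMr.
have etaM : mu + eta * M < 0.
  have : eta * (M + 1) = - mu / 2 by rewrite /eta; field; rewrite gt_eqF.
  lra.
apply: (drift_eventually_le Zmu etaM).
have Y0 := cvg_mean_last Ymu.
have Ydl : \forall n \near \oo, `|n.+1%:R^-1 * Y n| < dl.
  by move/cvgr0Pnorm_lt : Y0; apply.
have Yeta : \forall n \near \oo, `|n.+1%:R^-1 * Y n| < eta / C.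
  by move/cvgr0Pnorm_lt : Y0; apply; rewrite divr_gt0.
near=> n => s_gt.
have n0 : (0 < n)%N by near: n; exists 1%N.
suff : s n.+1 - s n <= n.+1%:R^-1 * Z n.
  rewrite -(mean_recr Z n0); move: (_ * mean Z n) => q; lra.
have s_rec_n : phi (s n - s n.+1) = - (n.+1%:R^-1 * h (x n - s n.+1)).
  by near: n.
have z_dl : `|n.+1%:R^-1 * Y n| < dl by near: n.
have z_eta : `|n.+1%:R^-1 * Y n| < eta / C by near: n.
pose z := n.+1%:R^-1 * Y n.
rewrite -/z -normrN in z_dl.
rewrite -/z ltr_pdivlMr// in z_eta.
have [v phiv vz] := phi_inv _ z_dl.
have vs : v <= s n - s n.+1.
  apply: phi_le; rewrite phiv s_rec_n lerN2 ler_wpM2l ?invr_ge0//.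
  by apply: h_nd; rewrite lerB// ltW.
have zE : z ^+ 2 = `|z| * `|z| by rewrite -expr2 real_normK ?num_real.
have ZE : n.+1%:R^-1 * Z n = z + eta * `|z|.
  rewrite /Z mulrDr -/z mulrCA /z normrM.
  by rewrite (ger0_norm (_ : 0 <= n.+1%:R^-1)) ?invr_ge0.
rewrite ZE.
have : C * z ^+ 2 <= eta * `|z| by rewrite zE mulrA ler_wpM2r// mulrC ltW.
move: vz; rewrite sqrrN opprK ler_norml => /andP[vz _].
lra.
Unshelve. all: by end_near. Qed.

(** * Almost sure convergence *)

Lemma pairwise_iid_of_iid1 (d : measure_display) (T : measurableType d)
    (R : realType) (P : probability T R) (X : nat -> {RV P >-> R}) :
  iid1 X -> pairwise_iid (fun k => X k.+1).
Proof.
move=> [X_indep X_ident]; split; last by move=> k A mA; exact: X_ident.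
move=> j k jk A B mA mB.
pose C i := if i == j.+1 then A else B.
have Cj : C j.+1 = A by rewrite /C eqxx.
have Ck : C k.+1 = B by rewrite /C eqSS eq_sym (negbTE jk).
have := X_indep [fset j.+1; k.+1]%fset C.
rewrite big_fsetU1 ?inE ?eqSS//= big_seq_fset1 Cj Ck => <-.
- congr (P _); apply/seteqP; split => [w [Aw Bw] i /=|w ABw].
    by rewrite !inE => /orP[]/eqP->; rewrite ?Cj ?Ck.
  split.
    by rewrite -Cj; apply: (ABw j.+1) => /=; rewrite !inE eqxx.
  by rewrite -Ck; apply: (ABw k.+1) => /=; rewrite !inE eqxx orbT.
- by move=> i /=; rewrite !inE => /orP[]/eqP->.
- by move=> i; rewrite /C; case: ifP.
Qed.

(** Beyond [expR 1] the factor [logp y] is at least 1. *)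
Lemma ler_expR1_mul_logp (R : realType) (y : R) : 0 <= y ->
  y <= expR 1 + y * logp y.
Proof.
move=> y0; have [ye|ey] := leP y (expR 1).
  by rewrite (le_trans ye)// lerDl mulr_ge0// le_max lexx orbT.
have ln1 : 1 <= logp y.
  rewrite le_max; apply/orP; left.
  rewrite -[leLHS](expRK 1) ler_ln ?posrE ?expR_gt0//; first exact: ltW.
  by rewrite (lt_trans _ ey)// expR_gt0.
rewrite (@le_trans _ _ (y * logp y)) ?lerDr ?expR_ge0//.
by rewrite ler_peMr.
Qed.

Lemma integrable_of_LlogL (d : measure_display) (T : measurableType d)
    (R : realType) (P : probability T R) (Y : T -> R) :
  measurable_fun [set: T] Y ->
  ('E_P[(fun w => `|Y w| * logp `|Y w|)%R] < +oo)%E ->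
  P.-integrable [set: T] (EFin \o Y).
Proof.
move=> mY; rewrite unlock => Yfin.
have mlogp : measurable_fun [set: T] (fun w => `|Y w| * logp `|Y w|).
  have mabs : measurable_fun [set: T] (fun w => `|Y w|).
    exact: measurableT_comp.
  apply: measurable_funM => //; apply: measurable_maxr => //.
  exact: (measurableT_comp (@measurable_ln R)).
have logp_ge0 w : 0 <= `|Y w| * logp `|Y w|.
  by rewrite mulr_ge0// le_max lexx orbT.
apply: (@le_integrable _ _ _ _ _ measurableT _
    (EFin \o (fun w => expR 1 + `|Y w| * logp `|Y w|))).
- exact/measurable_EFinP.
- move=> w _; rewrite /= lee_fin [leRHS]ger0_norm ?addr_ge0 ?expR_ge0//.
  exact: ler_expR1_mul_logp.
- apply: (@integrableD _ _ _ _ _ measurableT (cst (expR 1)%:E)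
    (EFin \o (fun w => `|Y w| * logp `|Y w|))).
    exact: (@bounded_integrable _ _ _ _ (fun=> expR 1) `|expR 1|).
  apply/integrableP; split; first exact/measurable_EFinP.
  by under eq_integral do rewrite gee0_abs ?lee_fin//.
Qed.

Section ImplicitApproximation.
Context (d : measure_display) (T : measurableType d) (R : realType)
  (P : probability T R) (X : nat -> {RV P >-> R}) (h phi : R -> R).
Hypothesis X_iid : pairwise_iid X.
Hypothesis h_nd : forall u v, u <= v -> h u <= h v.
Hypothesis h_int : forall r,
  P.-integrable [set: T] (EFin \o (fun w => h (X 0%N w - r))).
Hypothesis phi_le : forall u v, phi u <= phi v -> u <= v.
Hypothesis phi_inv : near_identity_inverse phi.

Let mh r : measurable_fun [set: R] (fun x => h (x - r)).
Proof.
by apply: nondecreasing_measurable => // u v uv; rewrite h_nd// lerB.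
Qed.

Let mabsh r : measurable_fun [set: R] (fun x => `|h (x - r)|).
Proof. exact: measurableT_comp. Qed.

(** The upper bound on [s] comes from the pathwise estimate at the levels
    [1 / i.+1]; the lower bound is the same estimate for the reflected data
    [- X], [- s], [fun v => - h (- v)] and [fun v => - phi (- v)]. Only countably
    many levels are used, so one null set suffices. *)
Lemma implicit_approximation_cvg0 (s : nat -> T -> R) :
  (forall r, 0 < r -> \int[P]_w h (X 0%N w - r) < 0) ->
  (forall r, r < 0 -> 0 < \int[P]_w h (X 0%N w - r)) ->
  {ae P, forall w, forall n, (1 <= n)%N ->
     phi (s n w - s n.+1 w) = - (n.+1%:R^-1 * h (X n w - s n.+1 w))} ->
  {ae P, forall w, s n w @[n --> \oo] --> (0 : R)}.
Proof.
move=> H_neg H_pos s_rec.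
pose r (i : nat) : R := i.+1%:R^-1.
(* The sign [sg] will be [1] for the upper bound and [- 1] for the lower one. *)
have laws (sg : R) i : {ae P, forall w,
    mean (fun n => h (X n w - sg * r i)) n @[n --> \oo]
      --> \int[P]_w h (X 0%N w - sg * r i) /\
    mean (fun n => `|h (X n w - sg * r i)|) n @[n --> \oo]
      --> \int[P]_w `|h (X 0%N w - sg * r i)|}.
  apply: filterS2 (strong_law X_iid (mh _) (h_int _))
    (strong_law X_iid (mabsh _) (integrable_norm (h_int (sg * r i)))).
  move=> w H1 H2.
  by split; [exact: H1|exact: H2].
apply: filterS3 s_rec (ae_foralln (laws 1)) (ae_foralln (laws (- 1))).
move=> w s_rec up down.
apply/cvgr0Pnorm_le => e e0.
pose i := Num.truncn (2 / e).
have ri0 : 0 < r i by rewrite invr_gt0.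
have rie : r i <= e / 2.
  rewrite /r -[leRHS]invrK lef_pV2 ?posrE ?invr_gt0 ?divr_gt0//.
  by rewrite invf_div ltW// Num.Theory.truncnS_gt.
have e2 : 0 < e / 2 by rewrite divr_gt0.
have s_rec' : \forall n \near \oo,
    phi (s n w - s n.+1 w) = - (n.+1%:R^-1 * h (X n w - s n.+1 w)).
  by exists 1%N.
have upper : \forall n \near \oo, s n w <= r i + e / 2.
  have [] := up i; rewrite mul1r => m1 m2.
  exact: (implicit_step_eventually_le phi_le phi_inv h_nd s_rec' m1
    (H_neg _ ri0) m2).
have lower : \forall n \near \oo, - s n w <= r i + e / 2.
  pose phi' v := - phi (- v); pose h' v := - h (- v).
  have phi'_le u v : phi' u <= phi' v -> u <= v.
    by rewrite lerN2 => /phi_le; rewrite lerN2.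
  have phi'_inv : near_identity_inverse phi'.
    have [C [dl [C0 dl0 inv]]] := phi_inv; exists C, dl; split=> // z zdl.
    have [|v phiv vz] := inv (- z); first by rewrite normrN.
    exists (- v); first by rewrite /phi' opprK phiv opprK.
    by rewrite -opprD normrN; move: vz; rewrite opprK sqrrN.
  have h'_nd u v : u <= v -> h' u <= h' v.
    by move=> uv; rewrite lerN2 h_nd// lerN2.
  have s'_rec : \forall n \near \oo, phi' (- s n w - - s n.+1 w) =
      - (n.+1%:R^-1 * h' (- X n w - - s n.+1 w)).
    apply: filterS s_rec' => n; rewrite /phi' /h' -!opprD !opprK => ->.
    by rewrite mulrN.
  have h'E n : h' (- X n w - r i) = - h (X n w - (- 1) * r i).
    by rewrite /h'; congr (- h _); ring.
  have [m1 m2] := down i.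
  apply: (implicit_step_eventually_le phi'_le phi'_inv h'_nd s'_rec
    (mu := - \int[P]_w h (X 0%N w - (- 1) * r i))
    (M := \int[P]_w `|h (X 0%N w - (- 1) * r i)|)) => //.
  - rewrite (_ : mean _ =
        (fun n => - mean (fun n => h (X n w - (- 1) * r i)) n)).
      exact: cvgN.
    apply/funext => n; rewrite /mean -mulrN -sumrN; congr (_ * _).
    by apply: eq_bigr => k _; exact: h'E.
  - by rewrite oppr_lt0 H_pos// mulN1r oppr_lt0.
  - rewrite (_ : mean _ = mean (fun n => `|h (X n w - (- 1) * r i)|))//.
    by congr mean; apply/funext => n; rewrite h'E normrN.
near=> n.
have sn_up : s n w <= r i + e / 2 by near: n.
have sn_low : - s n w <= r i + e / 2 by near: n.
by rewrite ler_norml; apply/andP; split; lra.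
Unshelve. all: by end_near. Qed.

End ImplicitApproximation.

Theorem proposition4p5 (d : measure_display) (T : measurableType d)
    (R : realType) (P : probability T R)
    (X : nat -> {RV P >-> R}) (h : R -> R)
    (X_iid : iid1 X)
    (h_nd : forall x y : R, x <= y -> h x <= h y)
    (h_LlogL : forall r : R,
      ('E_P[(fun w => `|h (X 1%N w - r)| * logp `|h (X 1%N w - r)|)%R] < +oo)%E)
    (h_root : forall x : R, ('E_P[(fun w => h (X 1%N w - x))%R] = 0)%E <-> x = 0) :
  (forall (s1 : R) (s : nat -> {RV P >-> R}),
     (forall w, s 1%N w = s1) ->
     {ae P, forall w, forall n : nat, (2 <= n)%N ->
        n%:R^-1 * h (X n w - s n w) + s n.-1 w = s n w} ->
     {ae P, forall w, s n w @[n --> \oo] --> (0 : R)})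
  /\
  (injective h -> inverse_id_plus_bigO_sqr h ->
   forall (s1 : R) (s : nat -> {RV P >-> R}),
     (forall w, s 1%N w = s1) ->
     {ae P, forall w, forall n : nat, (2 <= n)%N ->
        n%:R^-1 * h (X n w - s n w) + h (s n.-1 w - s n w) = 0} ->
     {ae P, forall w, s n w @[n --> \oo] --> (0 : R)}).
Proof.
have iid := pairwise_iid_of_iid1 X_iid.
have h_int r : P.-integrable [set: T] (EFin \o (fun w => h (X 1%N w - r))).
  apply: integrable_of_LlogL (h_LlogL r); apply: measurableT_comp.
    exact: nondecreasing_measurable.
  exact: measurable_funB.
pose H r := \int[P]_w h (X 1%N w - r).
have HE r : ('E_P[(fun w => h (X 1%N w - r))%R] = (H r)%:E)%E.
  by rewrite unlock /H /Rintegral fineK// (integrable_fin_num _ (h_int r)).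
have H0 r : H r = 0 <-> r = 0.
  split=> [Hr|/h_root]; first by apply/h_root; rewrite HE Hr.
  by rewrite HE => -[].
have H_ni u v : u <= v -> H v <= H u.
  by move=> uv; apply: le_Rintegral => // w _; rewrite h_nd// lerB.
have H_neg r : 0 < r -> H r < 0.
  move=> r0; rewrite lt_neqAle -[X in _ <= X](H0 0).2// H_ni ?(ltW r0)// andbT.
  by apply/eqP => /H0 rE; rewrite rE ltxx in r0.
have H_pos r : r < 0 -> 0 < H r.
  move=> r0; rewrite lt_neqAle -[X in X <= _](H0 0).2// H_ni ?(ltW r0)// andbT.
  by apply/eqP => /esym/H0 rE; rewrite rE ltxx in r0.
split=> [s1 s _ s_rec|h_inj [h_range [C [dl [C0 dl0 h_inv]]]] s1 s _ s_rec].
  apply: (@implicit_approximation_cvg0 _ _ _ P _ h id iid h_nd h_int _ _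
    (fun n => s n : T -> R) H_neg H_pos) => //.
    exists 1, 1; split=> // z _.
    by exists z; rewrite ?subrr ?normr0 ?mul1r ?sqr_ge0.
  apply: filterS s_rec => w s_rec n n1.
  have /= sE := s_rec n.+1 n1.
  by rewrite -[in LHS]sE opprD addrCA subrr addr0.
apply: (@implicit_approximation_cvg0 _ _ _ P _ h h iid h_nd h_int _ _
    (fun n => s n : T -> R) H_neg H_pos) => //.
- move=> u v huv; rewrite leNgt; apply/negP => vu.
  have := h_inj u v; rewrite (le_anti (_ : h u <= h v <= h u)) ?huv ?h_nd ?ltW//.
  by move=> /(_ erefl) uvE; rewrite uvE ltxx in vu.
- have [dl' /= dl'0 range_dl'] := h_range.
  exists C, (Num.min dl dl'); split=> //; first by rewrite lt_min dl0.
  move=> z; rewrite lt_min => /andP[zdl zdl'].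
  exists ('pinv_(fun=> 0) setT h z); last exact: h_inv.
  apply: pinvK; rewrite inE; apply: range_dl' => /=.
  by rewrite sub0r normrN.
- apply: filterS s_rec => w s_rec n n1.
  by have /eqP := s_rec n.+1 n1; rewrite addrC addr_eq0 => /eqP.
Qed.
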